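(* Consider the optimization problem $$\inf_{x\in\mathbb{R}^n}\{f(x): Ax\le b,\ g_i(x)\le0,\ i=1,\ldots,p\},\qquad (P)$$ where $A$ is a $q\times n$ real matrix and $b\in\mathbb{R}^q$. Assume that (A1) $f:\mathbb{R}^n\to\mathbb{R}\cup\{+\infty\}$ is strongly convex and has Lipschitz continuous gradient; (A2) $g_i:\mathbb{R}^n\to\mathbb{R}\cup\{+\infty\}$, $i=1,\ldots,p$, are convex and have Lipschitz continuous gradients; (A3) if $x_*$ is the optimal solution of (P), then the rows of the matrix $\begin{pmatrix}A\\ J_g(x_* )\end{pmatrix}$ are linearly independent, where $J_g(x)$ denotes the Jacobian matrix of $g(x)=(g_1(x),\ldots,g_p(x))$ at $x$; (A4) there is $x_0\in\mathrm{ri}(\{g\le0\})$ such that $Ax_0\le b$. Let $\theta$ be the dual function $$\theta(\lambda,\mu)=\inf_{x\in\mathbb{R}^n}\{f(x)+\lambda^T(Ax-b)+\mu^Tg(x)\},$$ and let $(\lambda_*,\mu_* )\ge0$ be an optimal solution of the dual problem $\sup_{\lambda\ge0,\mu\ge0}\theta(\lambda,\mu)$. Then there is some neighborhood $\mathcal{N}$ of $(\lambda_*,\mu_* )$ such that $\theta$ is strongly concave on $\mathcal{N}\cap\mathbb{R}_+^{p+q}$.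
   Context: $\mathrm{ri}$ denotes relative interior and $\{g\le0\}=\{x: g_i(x)\le0,\ i=1,\ldots,p\}$. A function $h:D\to\mathbb{R}\cup\{+\infty\}$ on a nonempty convex set $D$ is strongly convex (here with respect to $\|\cdot\|_2$) if for some $\alpha>0$, $h(tx+(1-t)y)\le th(x)+(1-t)h(y)-\frac{\alpha t(1-t)}2\|y-x\|_2^2$ for all $x,y\in D$ where $h$ is finite and all $t\in[0,1]$; $h$ is strongly concave if $-h$ is strongly convex. *)

(* Defs.v *)
From HB Require Import structures.
From mathcomp Require Import all_boot all_order all_algebra.
From mathcomp Require Import all_classical all_reals all_analysis.

Set Implicit Arguments.
Unset Strict Implicit.
Unset Printing Implicit Defensive.

Import Order.TTheory GRing.Theory Num.Theory.
Import numFieldNormedType.Exports.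

Local Open Scope classical_set_scope.
Local Open Scope ring_scope.

(* Points of R^n are row vectors, as required by [jacobian].  The canonical
   norm on ['rV[R]_n] is the sup norm, hence a separate Euclidean norm. *)
Definition enorm (R : realType) (n : nat) (x : 'rV[R]_n) : R :=
  Num.sqrt (\sum_(i < n) x 0 i ^+ 2).

Definition nonneg (R : realType) (n : nat) (x : 'rV[R]_n) : Prop :=
  forall i, 0 <= x 0 i.

Definition affine_hull (R : realType) (n : nat) (C : set 'rV[R]_n)
    : set 'rV[R]_n :=
  [set x | exists (k : nat) (c : 'I_k -> R) (y : 'I_k -> 'rV[R]_n),
     [/\ forall i, C (y i), \sum_(i < k) c i = 1 &
         x = \sum_(i < k) c i *: y i]].

Definition relint (R : realType) (n : nat) (C : set 'rV[R]_n)
    : set 'rV[R]_n :=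
  [set x | C x /\ \forall y \near x, affine_hull C y -> C y].

(* [h : D -> R U {+oo}] on a nonempty convex set [D], with convexity modulus
   [alpha]; plain convexity is the case [alpha = 0]. *)
Definition convex_modulus (R : realType) (n : nat) (alpha : R)
    (D : set 'rV[R]_n) (h : 'rV[R]_n -> \bar R) : Prop :=
  [/\ D !=set0, convex_set (D : set (convex_lmodType 'rV[R]_n)),
      (forall x, D x -> h x != -oo%E) &
      forall (x y : 'rV[R]_n) (t : R), D x -> D y ->
        h x \is a fin_num -> h y \is a fin_num -> 0 <= t <= 1 ->
        (h (t *: x + (1 - t) *: y)%R <=
           t%:E * h x + (1 - t)%:E * h y
           - (alpha * t * (1 - t) / 2 * enorm (y - x) ^+ 2)%:E)%E].

Definition econvex (R : realType) (n : nat) (D : set 'rV[R]_n)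
    (h : 'rV[R]_n -> \bar R) : Prop :=
  convex_modulus 0 D h.

Definition strongly_convex (R : realType) (n : nat) (D : set 'rV[R]_n)
    (h : 'rV[R]_n -> \bar R) : Prop :=
  exists2 alpha : R, 0 < alpha & convex_modulus alpha D h.

Definition strongly_concave (R : realType) (n : nat) (D : set 'rV[R]_n)
    (h : 'rV[R]_n -> \bar R) : Prop :=
  strongly_convex D (fun x => - h x)%E.

(* An extended-real-valued function is differentiable at [x] when it is finite
   near [x] and its real-valued representative is differentiable at [x]. *)
Definition ediffable (R : realType) (n : nat) (h : 'rV[R]_n -> \bar R)
    (x : 'rV[R]_n) : Prop :=
  (\forall y \near x, h y \is a fin_num) /\
  differentiable (fun y => fine (h y)) x.

Definition grad (R : realType) (n : nat) (h : 'rV[R]_n -> \bar R)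
    (x : 'rV[R]_n) : 'rV[R]_n :=
  \row_(j < n) 'D_(delta_mx 0 j) (fun y => fine (h y)) x.

Definition lipschitz_gradient (R : realType) (n : nat)
    (h : 'rV[R]_n -> \bar R) : Prop :=
  (forall x, ediffable h x) /\
  exists L : R, forall x y, enorm (grad h x - grad h y) <= L * enorm (x - y).

(* [jacobian] acts on the right of row vectors, so it is the transpose of the
   usual p x n Jacobian matrix. *)
Definition Jac (R : realType) (n p : nat) (g : 'I_p -> 'rV[R]_n -> \bar R)
    (x : 'rV[R]_n) : 'M[R]_(p, n) :=
  (jacobian (fun y : 'rV[R]_n => \row_(i < p) fine (g i y)) x)^T.

Definition sublevel (R : realType) (n p : nat)
    (g : 'I_p -> 'rV[R]_n -> \bar R) : set 'rV[R]_n :=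
  [set x | forall i, (g i x <= 0)%E].

Definition linear_feasible (R : realType) (n q : nat) (A : 'M[R]_(q, n))
    (b : 'cV[R]_q) : set 'rV[R]_n :=
  [set x | forall i, (A *m x^T) i 0 <= b i 0].

Definition primal_optimal (R : realType) (n p q : nat)
    (f : 'rV[R]_n -> \bar R) (g : 'I_p -> 'rV[R]_n -> \bar R)
    (A : 'M[R]_(q, n)) (b : 'cV[R]_q) (x : 'rV[R]_n) : Prop :=
  (linear_feasible A b `&` sublevel g) x /\
  forall y, (linear_feasible A b `&` sublevel g) y -> (f x <= f y)%E.

Definition dual_function (R : realType) (n p q : nat)
    (f : 'rV[R]_n -> \bar R) (g : 'I_p -> 'rV[R]_n -> \bar R)
    (A : 'M[R]_(q, n)) (b : 'cV[R]_q)
    (lam : 'rV[R]_q) (mu : 'rV[R]_p) : \bar R :=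
  ereal_inf (range (fun x : 'rV[R]_n =>
    (f x + ((lam *m (A *m x^T - b)) 0 0)%:E
         + \sum_(i < p) (mu 0 i)%:E * g i x)%E)).

Definition dual_optimal (R : realType) (n p q : nat)
    (f : 'rV[R]_n -> \bar R) (g : 'I_p -> 'rV[R]_n -> \bar R)
    (A : 'M[R]_(q, n)) (b : 'cV[R]_q)
    (lam : 'rV[R]_q) (mu : 'rV[R]_p) : Prop :=
  [/\ nonneg lam, nonneg mu &
      forall lam' mu', nonneg lam' -> nonneg mu' ->
        (dual_function f g A b lam' mu' <= dual_function f g A b lam mu)%E].

(* Main.v *)
Require Import Defs.
From HB Require Import structures.
From mathcomp Require Import all_boot all_order all_algebra.
From mathcomp Require Import all_classical all_reals all_analysis.
From mathcomp Require Import ring lra.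

Set Implicit Arguments.
Unset Strict Implicit.
Unset Printing Implicit Defensive.

Import Order.TTheory GRing.Theory Num.Theory.
Import numFieldNormedType.Exports.

Local Open Scope classical_set_scope.
Local Open Scope ring_scope.

(** Write z = (lambda, mu) for the multipliers, c(x) = (A x - b, g(x)) for the
    constraints, J(x) for their Jacobian, L(z, x) = f(x) + <z, c(x)>, and x(z)
    for a minimizer of L(z, .), so that theta(z) = L(z, x(z)).  Being
    differentiable everywhere, f and the g_i are finite, so everything happens
    over the reals.

    The heart of the proof is one gradient step.  The gradient of L(z', .) at
    x(z) is J(x(z))^T (z' - z), because that of L(z, .) vanishes there.  As
    L(z', .) is smooth, one step from x(z) decreases it by a multiple of the
    squared length of its gradient:
      theta(z') <= theta(z) + <c(x(z)), z' - z> - |J(x(z))^T (z' - z)|^2 / 4M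
    ([dual_supergradient]), where M is the quadratic coefficient of an upper
    model of L(z', .).  If the rows of J(x(z)) are independent, uniformly
    for z near the dual optimum, then the last term is at least a multiple of
    |z' - z|^2 ([dual_supergradient_near]), and such a quadratic supergradient
    inequality at every point of a convex set is strong concavity.

    The uniformity comes from three facts: full row rank is stable under
    perturbation ([row_free_expand]), J is Lipschitz, and z |-> x(z) is
    Lipschitz at the dual optimum by strong convexity of the Lagrangian
    ([minimizer_lipschitz]).  The qualification condition is known at primal
    optima only, so it remains to see that x(z) is one when z is dual optimal:
    moving one multiplier at a time, maximality of theta forces c(x(z)) <= 0 and
    complementary slackness ([dual_max_kkt]), and a feasible minimizer of
    L(z, .) with complementary slackness is primal optimal.

    Convexity and smoothness enter only through a pair of quadratic models, one
    below and one above each function ([sandwich]); this notion is stable under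
    sums and nonnegative scaling, hence passes to the Lagrangian.
    [gradient_sandwich] obtains the models from convexity and the Lipschitz
    gradient. *)

(** * Euclidean inner product *)

Definition dot (R : realType) (n : nat) (u v : 'rV[R]_n) : R :=
  \sum_(i < n) u 0 i * v 0 i.

Lemma enorm_sqr (R : realType) (n : nat) (x : 'rV[R]_n) :
  enorm x ^+ 2 = dot x x.
Proof.
rewrite /enorm sqr_sqrtr; first by apply: eq_bigr => i _; rewrite expr2.
by apply: sumr_ge0 => i _; rewrite sqr_ge0.
Qed.

Lemma dotC (R : realType) (n : nat) (u v : 'rV[R]_n) : dot u v = dot v u.
Proof. by apply: eq_bigr => i _; rewrite mulrC. Qed.

Lemma dotDl (R : realType) (n : nat) (u v w : 'rV[R]_n) :
  dot (u + v) w = dot u w + dot v w.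
Proof. by rewrite -big_split; apply: eq_bigr => i _; rewrite mxE mulrDl. Qed.

Lemma dotZl (R : realType) (n : nat) (a : R) (u v : 'rV[R]_n) :
  dot (a *: u) v = a * dot u v.
Proof. by rewrite mulr_sumr; apply: eq_bigr => i _; rewrite mxE mulrA. Qed.

Lemma dotNl (R : realType) (n : nat) (u v : 'rV[R]_n) :
  dot (- u) v = - dot u v.
Proof. by rewrite -scaleN1r dotZl mulN1r. Qed.

Lemma dot0l (R : realType) (n : nat) (v : 'rV[R]_n) : dot 0 v = 0.
Proof. by apply: big1 => i _; rewrite mxE mul0r. Qed.

Lemma dotDr (R : realType) (n : nat) (u v w : 'rV[R]_n) :
  dot w (u + v) = dot w u + dot w v.
Proof. by rewrite dotC dotDl !(dotC w). Qed.

Lemma dotZr (R : realType) (n : nat) (a : R) (u v : 'rV[R]_n) :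
  dot u (a *: v) = a * dot u v.
Proof. by rewrite dotC dotZl dotC. Qed.

Lemma dotNr (R : realType) (n : nat) (u v : 'rV[R]_n) :
  dot u (- v) = - dot u v.
Proof. by rewrite dotC dotNl dotC. Qed.

Definition dotE := (dotDl, dotDr, dotNl, dotNr, dotZl, dotZr).

Lemma dot_delta (R : realType) (n : nat) (k : 'I_n) (v : 'rV[R]_n) :
  dot (delta_mx 0 k) v = v 0 k.
Proof.
rewrite /dot (bigD1 k) //= mxE !eqxx mul1r big1 ?addr0 // => i ik.
by rewrite mxE (negPf ik) andbF mul0r.
Qed.

Lemma dot_ge0 (R : realType) (n : nat) (u : 'rV[R]_n) : 0 <= dot u u.
Proof. by apply: sumr_ge0 => i _; rewrite -expr2 sqr_ge0. Qed.

Lemma sqr_coord_le (R : realType) (n : nat) (u : 'rV[R]_n) (k : 'I_n) :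
  u 0 k ^+ 2 <= dot u u.
Proof.
rewrite /dot (bigD1 k) //= expr2 lerDl; apply: sumr_ge0 => i _.
by rewrite -expr2 sqr_ge0.
Qed.

Lemma dot_eq0 (R : realType) (n : nat) (u : 'rV[R]_n) :
  dot u u <= 0 -> u = 0.
Proof.
move=> u0; apply/rowP => k; rewrite mxE; apply/eqP.
by rewrite -sqrf_eq0 eq_le sqr_ge0 (le_trans (sqr_coord_le u k)).
Qed.

Lemma dot_young (R : realType) (n : nat) (l : R) (u v : 'rV[R]_n) : 0 < l ->
  dot u v <= dot u u / (2 * l) + l / 2 * dot v v.
Proof.
move=> l0; have := dot_ge0 (u - l *: v); rewrite !dotE (dotC v u) => H.
rewrite -(ler_pM2l (_ : 0 < 2 * l)) ?mulr_gt0 //.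
have -> : 2 * l * (dot u u / (2 * l) + l / 2 * dot v v)
  = dot u u + l * l * dot v v by field; lra.
lra.
Qed.

Lemma cauchy_schwarz (R : realType) (n : nat) (u v : 'rV[R]_n) :
  dot u v ^+ 2 <= dot u u * dot v v.
Proof.
have [v0|v0] := leP (dot v v) 0.
  have -> : v = 0 by exact: dot_eq0.
  by rewrite dotC !dot0l expr0n mulr0.
have := dot_ge0 (dot v v *: u - dot u v *: v).
rewrite !dotE (dotC v u) => H.
by rewrite -subr_ge0 -(pmulr_rge0 _ v0); lra.
Qed.

(** Squared Frobenius norm, the simplest bound for the squared operator norm. *)
Definition frob (R : realType) (m n : nat) (B : 'M[R]_(m, n)) : R :=
  \sum_(k < m) dot (row k B) (row k B).

Lemma frob_ge0 (R : realType) (m n : nat) (B : 'M[R]_(m, n)) : 0 <= frob B.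
Proof. by apply: sumr_ge0 => k _; exact: dot_ge0. Qed.

Lemma dot_mulmx_le (R : realType) (m n : nat) (v : 'rV[R]_m)
    (B : 'M[R]_(m, n)) :
  dot (v *m B) (v *m B) <= dot v v * frob B.
Proof.
have -> : frob B = \sum_(j < n) dot (row j B^T) (row j B^T).
  rewrite /frob /dot exchange_big /=; apply: eq_bigr => j _.
  by apply: eq_bigr => i _; rewrite !mxE.
rewrite mulr_sumr; apply: ler_sum => j _.
have -> : (v *m B) 0 j = dot v (row j B^T).
  by rewrite mxE; apply: eq_bigr => i _; rewrite !mxE.
by rewrite -expr2 cauchy_schwarz.
Qed.

(** Full row rank is stable: a matrix close to [B] in Frobenius norm still
    expands every vector by a factor bounded below. *)
Lemma row_free_expand (R : realType) (m n : nat) (B : 'M[R]_(m, n)) :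
  row_free B -> exists2 s : R, 0 < s & forall (C : 'M[R]_(m, n)) (v : 'rV[R]_m),
    frob (C - B) <= s -> s * dot v v <= dot (v *m C) (v *m C).
Proof.
case/row_freeP => D BD.
(* |v| <= |v B| |D| for a right inverse D of B, and the + 1 keeps K positive *)
pose K := frob D + 1.
have K0 : 0 < K by rewrite /K ltr_wpDl // frob_ge0.
exists (1 / (4 * K)) => [|C v CB].
  by rewrite divr_gt0 // mulr_gt0.
have vB : dot v v <= dot (v *m B) (v *m B) * K.
  have := dot_mulmx_le (v *m B) D; rewrite -mulmxA BD mulmx1.
  by have := dot_ge0 (v *m B); rewrite /K; lra.
have vCB : dot (v *m (C - B)) (v *m (C - B)) <= dot v v * (1 / (4 * K)).
  apply: le_trans (dot_mulmx_le _ _) _.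
  by rewrite ler_wpM2l // dot_ge0.
(* |a|^2 <= 2 |a + d|^2 + 2 |d|^2 with a = v B and d = v (C - B) *)
have two : dot (v *m B) (v *m B) <=
    2 * dot (v *m C) (v *m C) + 2 * dot (v *m (C - B)) (v *m (C - B)).
  rewrite mulmxBr; have := dot_ge0 (2 *: (v *m C) - v *m B).
  by rewrite !dotE (dotC (v *m B) (v *m C)); lra.
have vBK : dot v v * (1 / K) <= dot (v *m B) (v *m B).
  by rewrite mul1r ler_pdivrMr.
have e4 : 1 / K = 4 * (1 / (4 * K)) by field; rewrite gt_eqF.
rewrite e4 in vBK; clear BD; lra.
Qed.

(** * Functions between two quadratic models *)

(** Convexity with modulus [2 a] and the descent lemma with Lipschitz constant
    [2 l], with [dh] in the role of the gradient. *)
Definition sandwich (R : realType) (n : nat) (a l : R) (h : 'rV[R]_n -> R)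
    (dh : 'rV[R]_n -> 'rV[R]_n) : Prop :=
  [/\ continuous h,
      forall x y, h x + dot (dh x) (y - x) + a * dot (y - x) (y - x) <= h y &
      forall x y, h y <= h x + dot (dh x) (y - x) + l * dot (y - x) (y - x)].

Definition minimizer (R : realType) (n : nat) (h : 'rV[R]_n -> R)
    (x : 'rV[R]_n) : Prop := forall y, h x <= h y.

Lemma sandwichD (R : realType) (n : nat) (a1 l1 a2 l2 : R)
    (h1 h2 : 'rV[R]_n -> R) (d1 d2 : 'rV[R]_n -> 'rV[R]_n) :
  sandwich a1 l1 h1 d1 -> sandwich a2 l2 h2 d2 ->
  sandwich (a1 + a2) (l1 + l2) (fun x => h1 x + h2 x) (fun x => d1 x + d2 x).
Proof.
move=> [c1 lo1 up1] [c2 lo2 up2]; split => [x|x y|x y].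
- exact: (cvgD (c1 x) (c2 x)).
- by have := lo1 x y; have := lo2 x y; rewrite (dotDl (d1 x)); lra.
- by have := up1 x y; have := up2 x y; rewrite (dotDl (d1 x)); lra.
Qed.

Lemma sandwichZ (R : realType) (n : nat) (a l k : R)
    (h : 'rV[R]_n -> R) (d : 'rV[R]_n -> 'rV[R]_n) : 0 <= k ->
  sandwich a l h d ->
  sandwich (k * a) (k * l) (fun x => k * h x) (fun x => k *: d x).
Proof.
move=> k0 [c lo up]; split => [x|x y|x y].
- exact: (cvgM (cvg_cst k) (c x)).
- by have := ler_wpM2l k0 (lo x y); rewrite dotZl; lra.
- by have := ler_wpM2l k0 (up x y); rewrite dotZl; lra.
Qed.

Lemma sandwich0 (R : realType) (n : nat) :
  sandwich 0 0 (fun=> 0) (fun=> 0 : 'rV[R]_n).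
Proof.
split => [x|x y|x y]; first exact: (@cst_continuous _ _ (0 : R)).
- by rewrite dot0l; lra.
- by rewrite dot0l; lra.
Qed.

Lemma sandwich_sum (R : realType) (n m : nat) (a l : 'I_m -> R)
    (h : 'I_m -> 'rV[R]_n -> R) (d : 'I_m -> 'rV[R]_n -> 'rV[R]_n) :
  (forall k, sandwich (a k) (l k) (h k) (d k)) ->
  sandwich (\sum_(k < m) a k) (\sum_(k < m) l k)
    (fun x => \sum_(k < m) h k x) (fun x => \sum_(k < m) d k x).
Proof.
elim: m a l h d => [|m IH] a l h d H.
  rewrite !big_ord0; have := @sandwich0 R n.
  by congr sandwich; apply/funext => x; rewrite big_ord0.
rewrite !big_ord_recl.
have := sandwichD (H ord0) (IH _ _ _ _ (fun k => H (lift ord0 k))).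
by congr sandwich; apply/funext => x; rewrite big_ord_recl.
Qed.

(** A gradient step of length [1 / (2 l)] minimizes the upper model. *)
Lemma sandwich_descent (R : realType) (n : nat) (a l : R)
    (h : 'rV[R]_n -> R) (dh : 'rV[R]_n -> 'rV[R]_n) (x0 x : 'rV[R]_n) :
  0 < l -> sandwich a l h dh -> minimizer h x0 ->
  h x0 <= h x - dot (dh x) (dh x) / (4 * l).
Proof.
move=> l0 [_ _ up] min0; pose s := (2 * l)^-1.
apply: le_trans (min0 (x - s *: dh x)) _; apply: le_trans (up x _) _.
rewrite (addrC x) addrK; set N := dot (dh x) (dh x).
have -> : l * dot (- (s *: dh x)) (- (s *: dh x)) = s * N / 2.
  by rewrite !dotE -/N /s; field; lra.
have -> : dot (dh x) (- (s *: dh x)) = - (s * N) by rewrite !dotE.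
have -> : N / (4 * l) = s * N / 2 by rewrite /s; field; lra.
lra.
Qed.

Lemma minimizer_grad0 (R : realType) (n : nat) (a l : R)
    (h : 'rV[R]_n -> R) (dh : 'rV[R]_n -> 'rV[R]_n) (x : 'rV[R]_n) :
  0 < l -> sandwich a l h dh -> minimizer h x -> dh x = 0.
Proof.
move=> l0 hs hx; apply: dot_eq0; have := sandwich_descent x l0 hs hx.
rewrite -subr_ge0 addrC addKr oppr_ge0 pmulr_lle0 // invr_gt0.
by rewrite mulr_gt0.
Qed.

(** A strongly convex lower model leaves little room for points where [h] is no
    larger than at [x].  This bounds the sublevel sets, and the distance from
    [x] to a minimizer. *)
Lemma sandwich_sublevel (R : realType) (n : nat) (a l : R)
    (h : 'rV[R]_n -> R) (dh : 'rV[R]_n -> 'rV[R]_n) (x y : 'rV[R]_n) :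
  0 < a -> sandwich a l h dh -> h y <= h x ->
  dot (y - x) (y - x) <= dot (dh x) (dh x) / a ^+ 2.
Proof.
move=> a0 [_ lo _] hyx; have := lo x y; have := dot_young (- dh x) (y - x) a0.
rewrite dotNl !dotNr dotNl opprK.
set D := dot (y - x) _; set N := dot (dh x) (dh x) => h1 h2.
have {h1 h2}: D * a / 2 <= N / (2 * a) by lra.
rewrite -(ler_pM2r (_ : 0 < 2 / a)) ?divr_gt0 //.
have -> : D * a / 2 * (2 / a) = D by field; lra.
by have -> : N / (2 * a) * (2 / a) = N / a ^+ 2 by field; lra.
Qed.

Lemma sandwich_minimizer (R : realType) (n : nat) (a l : R)
    (h : 'rV[R]_n -> R) (dh : 'rV[R]_n -> 'rV[R]_n) :
  0 < a -> sandwich a l h dh -> exists x, minimizer h x.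
Proof.
move=> a0 hs; have [ch _ _] := hs; pose K := [set y | h y <= h 0].
have K0 : K 0 by rewrite /K /= lexx.
have Kc : closed K.
  apply: (@closed_comp _ _ h [set t | t <= h 0]); last exact: closed_le.
  by move=> x _; exact: ch.
have Kb : bounded_set K.
  pose B := dot (dh 0) (dh 0) / a ^+ 2 + 1.
  have B1 : 1 <= B by rewrite /B lerDr divr_ge0 ?dot_ge0 ?sqr_ge0.
  exists B; split; first exact: num_real.
  move=> M BM y Ky /=; rewrite [leLHS]/Num.Def.normr /= mx_normrE.
  apply: bigmax_le; first by lra.
  move=> [i j] _ /=; rewrite ord1.
  have yB : dot y y <= B.
    have := sandwich_sublevel a0 hs Ky; rewrite subr0 => /le_trans; apply.
    by rewrite /B lerDl.
  rewrite -(@ler_pXn2r _ 2) ?nnegrE //; last by lra.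
  rewrite real_normK ?num_real //.
  apply: le_trans (le_trans (sqr_coord_le y j) yB) _.
  (* the norm here is the sup norm: y_j^2 <= B <= B^2 < M^2 for each j *)
  rewrite expr2; nra.
have [x Kx xmin] : exists2 c, c \in K & forall t, t \in K -> h c <= h t.
  apply: EVT_min_rV; [by exists 0|exact: bounded_closed_compact|].
  exact: continuous_subspaceT.
exists x => y; have [yK|yK] := leP (h y) (h 0).
  by apply: xmin; rewrite inE.
by apply: le_trans (ltW yK); apply: xmin; rewrite inE.
Qed.

(** * Lagrangian minimizers *)

Definition lagrangian (R : realType) (n m : nat) (F : 'rV[R]_n -> R)
    (c : 'rV[R]_n -> 'rV[R]_m) (z : 'rV[R]_m) (x : 'rV[R]_n) : R :=
  F x + dot z (c x).

(** One family of quantitative hypotheses for the affine and the convex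
    constraints together; the same [lc k] serves as coefficient of the upper
    model and as Lipschitz constant of the gradient of the k-th constraint. *)
Record smooth_problem (R : realType) (n m : nat) (a lF : R) (lc : 'I_m -> R)
    (F : 'rV[R]_n -> R) (dF : 'rV[R]_n -> 'rV[R]_n)
    (c : 'rV[R]_n -> 'rV[R]_m) (J : 'rV[R]_n -> 'M[R]_(m, n)) : Prop := {
  sp_a : 0 < a;
  sp_lF : 0 < lF;
  sp_lc : forall k, 0 <= lc k;
  sp_F : sandwich a lF F dF;
  sp_c : forall k, sandwich 0 (lc k) (fun x => c x 0 k) (fun x => row k (J x));
  sp_J : forall k x y, dot (row k (J x - J y)) (row k (J x - J y)) <=
                       lc k ^+ 2 * dot (x - y) (x - y)
}.

Section lagrangian_minimizers.
Context (R : realType) (n m : nat) (a lF : R) (lc : 'I_m -> R).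
Context (F : 'rV[R]_n -> R) (dF : 'rV[R]_n -> 'rV[R]_n).
Context (c : 'rV[R]_n -> 'rV[R]_m) (J : 'rV[R]_n -> 'M[R]_(m, n)).
Context (SP : smooth_problem a lF lc F dF c J).

Let L := lagrangian F c.
Let M (z : 'rV[R]_m) := lF + \sum_(k < m) z 0 k * lc k.
Let dL (z : 'rV[R]_m) (x : 'rV[R]_n) := dF x + z *m J x.

Lemma lagrangian_sandwich z : nonneg z -> sandwich a (M z) (L z) (dL z).
Proof.
move=> z0; have := sandwichD (sp_F SP)
  (sandwich_sum (fun k => sandwichZ (z0 k) (sp_c SP k))).
rewrite [X in a + X]big1 ?addr0; last by move=> k _; rewrite mulr0.
congr sandwich; apply/funext => x.
by rewrite /dL mulmx_sum_row.
Qed.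

Lemma M_gt0 z : nonneg z -> 0 < M z.
Proof.
move=> z0; rewrite /M ltr_wpDr ?(sp_lF SP) //; apply: sumr_ge0 => k _.
by rewrite mulr_ge0 // (sp_lc SP).
Qed.

Lemma lagrangian_minimizer z : nonneg z -> exists x, minimizer (L z) x.
Proof. by move=> /lagrangian_sandwich; apply: sandwich_minimizer (sp_a SP). Qed.

Lemma lagrangian_shift z z' x : L z' x = L z x + dot (z' - z) (c x).
Proof. by rewrite /L /lagrangian !dotE; lra. Qed.

(** At a minimizer for [z] only the change of multipliers survives in the
    gradient of the Lagrangian for [z']. *)
Lemma lagrangian_grad_shift z z' x : nonneg z -> minimizer (L z) x ->
  dL z' x = (z' - z) *m J x.
Proof.
move=> z0 xmin.
have := minimizer_grad0 (M_gt0 z0) (lagrangian_sandwich z0) xmin.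
rewrite /dL mulmxBl => /eqP; rewrite addr_eq0 => /eqP ->.
by rewrite addrC.
Qed.

Lemma minimizer_lipschitz z z' x x' : nonneg z -> nonneg z' ->
  minimizer (L z) x -> minimizer (L z') x' ->
  dot (x' - x) (x' - x) <= frob (J x) / a ^+ 2 * dot (z' - z) (z' - z).
Proof.
move=> z0 z'0 xmin xmin'.
have := sandwich_sublevel (sp_a SP) (lagrangian_sandwich z'0) (xmin' x).
move=> /le_trans; apply.
rewrite (lagrangian_grad_shift _ z0 xmin) mulrAC ler_wpM2r //.
  by rewrite invr_ge0 sqr_ge0.
by rewrite mulrC dot_mulmx_le.
Qed.

(** One gradient step for the multiplier [z'] from the minimizer for [z]: the
    dual function lies below its linearization by the squared length of the
    step. *)
Lemma dual_supergradient z z' x x' : nonneg z -> nonneg z' ->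
  minimizer (L z) x -> minimizer (L z') x' ->
  L z' x' <= L z x + dot (z' - z) (c x)
             - dot ((z' - z) *m J x) ((z' - z) *m J x) / (4 * M z').
Proof.
move=> z0 z'0 xmin xmin'.
have := sandwich_descent x (M_gt0 z'0) (lagrangian_sandwich z'0) xmin'.
by rewrite (lagrangian_grad_shift _ z0 xmin) (lagrangian_shift z z' x).
Qed.

(** The gain of the gradient step is bounded below because [J x] stays close to
    [J x0] when the multipliers stay close to [z0]. *)
Lemma dual_supergradient_near z0 x0 :
  nonneg z0 -> minimizer (L z0) x0 -> row_free (J x0) ->
  exists2 r : R, 0 < r & exists2 s : R, 0 < s &
  forall z z' x x', nonneg z -> nonneg z' ->
    dot (z - z0) (z - z0) < r -> dot (z' - z0) (z' - z0) < r ->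
    minimizer (L z) x -> minimizer (L z') x' ->
    L z' x' <= L z x + dot (z' - z) (c x) - s * dot (z' - z) (z' - z).
Proof.
move=> z00 x0min /row_free_expand [e e0 expand].
pose S := \sum_(k < m) lc k ^+ 2.
have S0 : 0 <= S by apply: sumr_ge0 => k _; rewrite sqr_ge0.
(* |J x - J x0|^2 <= K |z - z0|^2 at the minimizer x for z *)
pose K := S * (frob (J x0) / a ^+ 2).
have K0 : 0 <= K by rewrite mulr_ge0 // divr_ge0 ?frob_ge0 // sqr_ge0.
(* bounds [M z'] as soon as |z' - z0| < 1 *)
pose B := lF + \sum_(k < m) (z0 0 k + 1) * lc k.
have B0 : 0 < B.
  rewrite /B ltr_wpDr ?(sp_lF SP) //; apply: sumr_ge0 => k _.
  by rewrite mulr_ge0 ?(sp_lc SP) // addr_ge0.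
exists (Num.min 1 (e / (K + 1))).
  by rewrite lt_min ltr01 divr_gt0 // ltr_wpDl.
exists (e / (4 * B)); first by rewrite divr_gt0 // mulr_gt0.
move=> z z' x x' zge z'ge; rewrite !lt_min => /andP[_ zr].
move=> /andP[z'1 _] xmin xmin'.
apply: le_trans (dual_supergradient zge z'ge xmin xmin') _.
rewrite lerD2l lerN2.
have JJ : frob (J x - J x0) <= e.
  have : frob (J x - J x0) <= S * dot (x - x0) (x - x0).
    by rewrite /frob /S mulr_suml; apply: ler_sum => k _; exact: (sp_J SP).
  move/le_trans; apply.
  apply: le_trans (ler_wpM2l S0 (minimizer_lipschitz z00 zge x0min xmin)) _.
  rewrite mulrA -/K; apply: le_trans (ler_wpM2l K0 (ltW zr)) _.
  rewrite mulrA ler_pdivrMr ?ltr_wpDl // mulrDr mulr1 (mulrC e) lerDl.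
  exact: ltW.
have MB : M z' <= B.
  rewrite /M /B lerD2l; apply: ler_sum => k _.
  rewrite ler_wpM2r ?(sp_lc SP) //.
  have := le_lt_trans (sqr_coord_le (z' - z0) k) z'1.
  by rewrite !mxE; nra.
have Mz := M_gt0 z'ge.
have H := expand _ (z' - z) JJ.
apply: (@le_trans _ _ (e * dot (z' - z) (z' - z) / (4 * M z'))).
  rewrite mulrAC ler_wpM2l ?mulr_ge0 ?dot_ge0 //; first exact: ltW.
  by rewrite lef_pV2 ?posrE ?mulr_gt0 // ler_pM2l.
by rewrite ler_wpM2r // invr_ge0 mulr_ge0 // ltW.
Qed.

(** * Optimality conditions from the dual maximizer *)

(** Moving the k-th multiplier by [s] changes the dual value by at least
    [s * c x 0 k], where [x] is the new minimizer; maximality makes this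
    nonpositive, and [c x 0 k] differs from [c x0 0 k] by [O(s)]. *)
Lemma dual_max_slope z0 x0 k : nonneg z0 -> minimizer (L z0) x0 ->
  (forall z x, nonneg z -> minimizer (L z) x -> L z x <= L z0 x0) ->
  exists2 C : R, 0 <= C & forall s, `|s| <= 1 -> 0 <= z0 0 k + s ->
    s * c x0 0 k <= C * s ^+ 2.
Proof.
move=> z00 x0min zmax.
pose K := frob (J x0) / a ^+ 2; pose d := row k (J x0).
have K0 : 0 <= K by rewrite divr_ge0 ?frob_ge0 // sqr_ge0.
have N0 := dot_ge0 d; have l0 := sp_lc SP k.
exists (dot d d / 2 + K / 2 + lc k * K).
  by rewrite 2?addr_ge0 // mulr_ge0 // invr_ge0 ler0n.
move=> s s1 zs; pose z := z0 + s *: delta_mx 0 k.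
have zz : z - z0 = s *: delta_mx 0 k by rewrite /z addrAC subrr add0r.
have zge : nonneg z.
  move=> j; rewrite !mxE eqxx /=; case: eqP => [->|_] /=.
    by rewrite mulr1.
  by rewrite mulr0 addr0.
have [x xmin] := lagrangian_minimizer zge.
have sx : s * c x 0 k <= 0.
  have := zmax _ _ zge xmin; rewrite (lagrangian_shift z0 z x).
  rewrite zz dotZl dot_delta; have := x0min x; lra.
pose D := dot (x - x0) (x - x0); have D0 : 0 <= D := dot_ge0 _.
have DK : D <= K * s ^+ 2.
  have := minimizer_lipschitz z00 zge x0min xmin.
  by rewrite zz dotZl dotZr dot_delta mxE !eqxx mulr1.
have [_ lo up] := sp_c SP k; have := lo x0 x; have := up x0 x.
rewrite -/d -/D; set G := dot d _ => hup hlo.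
have young : - (s * G) <= s ^+ 2 * dot d d / 2 + D / 2.
  have := dot_young (- (s *: d)) (x - x0) (ltr01 : 0 < 1 :> R).
  by rewrite !(dotNl, dotNr, dotZl, dotZr) -/D -/G; lra.
have lD : lc k * D <= lc k * (K * s ^+ 2) by rewrite ler_wpM2l.
have lD0 : 0 <= lc k * D by rewrite mulr_ge0.
have {lo up} : s * c x0 0 k <= s * c x 0 k - s * G + lc k * D.
  move: s1; rewrite ler_norml => /andP[sl su].
  have [s0|s0] := leP 0 s; first by nra.
  by nra.
lra.
Qed.

Lemma dual_max_kkt z0 x0 : nonneg z0 -> minimizer (L z0) x0 ->
  (forall z x, nonneg z -> minimizer (L z) x -> L z x <= L z0 x0) ->
  (forall k, c x0 0 k <= 0) /\ (forall k, z0 0 k * c x0 0 k = 0).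
Proof.
move=> z00 x0min zmax.
have cle k : c x0 0 k <= 0.
  have [C C0 slope] := dual_max_slope k z00 x0min zmax.
  rewrite leNgt; apply/negP => cpos.
  have den : 0 < c x0 0 k + C + 1 by lra.
  (* a step s <= 1 with C * s < c x0 0 k *)
  pose s := c x0 0 k / (c x0 0 k + C + 1).
  have s0 : 0 < s by rewrite divr_gt0.
  have sden : s * (c x0 0 k + C + 1) = c x0 0 k by rewrite divfK // gt_eqF.
  have s1 : s <= 1 by rewrite ler_pdivrMr //; lra.
  have := slope s; rewrite (ger0_norm (ltW s0)) => /(_ s1).
  rewrite (addr_ge0 (z00 k) (ltW s0)) => /(_ isT).
  rewrite expr2 [leRHS]mulrCA ler_pM2l //; nra.
split=> // k; have := z00 k; rewrite le_eqVlt => /predU1P[<-|zpos].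
  by rewrite mul0r.
suff -> : c x0 0 k = 0 by rewrite mulr0.
apply/eqP; rewrite eq_le cle /= leNgt; apply/negP => cneg.
have [C C0 slope] := dual_max_slope k z00 x0min zmax.
pose d := - c x0 0 k; have d0 : 0 < d by rewrite /d; lra.
have den : 0 < d + C + 1 by lra.
pose w := Num.min 1 (z0 0 k).
have w0 : 0 < w by rewrite lt_min ltr01.
have w1 : w <= 1 by rewrite ge_min lexx.
have wz : w <= z0 0 k by rewrite ge_min lexx orbT.
(* the step - (w * t) keeps the multiplier nonnegative, and C * t < d *)
pose t := d / (d + C + 1).
have t0 : 0 < t by rewrite divr_gt0.
have tden : t * (d + C + 1) = d by rewrite divfK // gt_eqF.
have t1 : t <= 1 by rewrite ler_pdivrMr //; lra.
have s0 : 0 < w * t by rewrite mulr_gt0.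
have sw : w * t <= w by rewrite ler_piMr // ltW.
have := slope (- (w * t)); rewrite normrN (ger0_norm (ltW s0)).
rewrite (le_trans sw w1) => /(_ isT).
rewrite subr_ge0 (le_trans sw wz) => /(_ isT).
rewrite sqrrN mulNr -mulrN -/d expr2 [leRHS]mulrCA ler_pM2l // => dC.
have : C * (w * t) <= C * t by rewrite ler_wpM2l // ler_piMl // ltW.
nra.
Qed.

End lagrangian_minimizers.

(** * From convexity and Lipschitz gradients to quadratic models *)

Lemma lipschitz_gradient_fin (R : realType) (n : nat) (h : 'rV[R]_n -> \bar R) :
  lipschitz_gradient h -> forall x, h x = (fine (h x))%:E.
Proof.
move=> [hd _] x; rewrite fineK //; have [hx _] := hd x.
exact: nbhs_singleton hx.
Qed.

Lemma derive_grad (R : realType) (n : nat) (h : 'rV[R]_n -> \bar R)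
    (x v : 'rV[R]_n) : ediffable h x ->
  'D_v (fun y => fine (h y)) x = dot (grad h x) v.
Proof.
move=> [_ hd]; rewrite deriveE // [in LHS](row_sum_delta v) linear_sum.
by apply: eq_bigr => j _; rewrite linearZ mxE deriveE // mulrC.
Qed.

(** The difference quotients of a convex function along [y - x] lie below the
    chord; let the step tend to 0 from the right. *)
Lemma convex_gradient_ineq (R : realType) (n : nat) (al : R)
    (h : 'rV[R]_n -> \bar R) :
  convex_modulus al setT h -> lipschitz_gradient h ->
  forall x y, fine (h x) + dot (grad h x) (y - x)
              + al / 2 * dot (y - x) (y - x) <= fine (h y).
Proof.
move=> [_ _ _ hc] hl x y; have hE := lipschitz_gradient_fin hl.
pose H z := fine (h z); pose D := dot (x - y) (x - y).
have conv t : 0 <= t <= 1 -> H (t *: y + (1 - t) *: x) <=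
    t * H y + (1 - t) * H x - al * t * (1 - t) / 2 * D.
  move=> t01; have := hc y x t I I.
  rewrite (hE x) (hE y) (hE (_ + _)) -!EFinM -EFinD lee_fin enorm_sqr.
  by apply.
have -> : dot (y - x) (y - x) = D by rewrite -opprB !(dotNl, dotNr) opprK.
pose B := H y - H x - al / 2 * D.
have [hd _] := hl; have /diff_derivable dx := (hd x).2.
rewrite -(derive_grad (y - x) (hd x)).
suff : 'D_(y - x) H x <= B by rewrite /B /H; lra.
have /cvg_dnbhs_at_right dcvg := dx (y - x).
have rcvg : (B + t * (al / 2 * D)) @[t --> (0 : R)^'+] --> B.
  rewrite -[X in _ --> X]addr0 -[X in _ + X](mul0r (al / 2 * D)).
  apply: cvg_at_right_filter; apply: cvgD; first exact: cvg_cst.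
  by apply: cvgMl; exact: cvg_id.
apply: (ler_cvg_to dcvg rcvg); near=> t.
have t0 : 0 < t by near: t; exact: nbhs_right_gt.
have t1 : t <= 1 by near: t; exact: nbhs_right_le.
(* the scalar action on R is the product *)
rewrite /= [_ *: _]mulrC ler_pdivrMr //.
have -> : t *: (y - x) + x = t *: y + (1 - t) *: x.
  by rewrite scalerBr scalerBl scale1r -addrA (addrC (- _)).
have := conv t; rewrite ltW //= t1 => /(_ isT); rewrite /B /H; nra.
Unshelve. all: by end_near. Qed.

(** The upper model needs no integration along the segment: convexity at [y]
    gives [h y <= h x + <grad h y, y - x>], and replacing [grad h y] by
    [grad h x] costs at most [l |y - x|^2]. *)
Lemma gradient_sandwich (R : realType) (n : nat) (al : R)
    (h : 'rV[R]_n -> \bar R) :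
  0 <= al -> convex_modulus al setT h -> lipschitz_gradient h ->
  exists2 l, 0 < l & sandwich (al / 2) l (fun x => fine (h x)) (grad h) /\
    forall x y, dot (grad h x - grad h y) (grad h x - grad h y) <=
                l ^+ 2 * dot (x - y) (x - y).
Proof.
move=> al0 hc hl; have lo := convex_gradient_ineq hc hl.
have [hd [K hK]] := hl; pose l := `|K| + 1.
have l0 : 0 < l by rewrite /l ltr_wpDl.
have lip x y : dot (grad h x - grad h y) (grad h x - grad h y) <=
               l ^+ 2 * dot (x - y) (x - y).
  rewrite -!enorm_sqr -exprMn ler_pXn2r ?nnegrE ?sqrtr_ge0 //; last first.
    by rewrite mulr_ge0 ?sqrtr_ge0 // ltW.
  apply: le_trans (hK x y) _; rewrite ler_wpM2r ?sqrtr_ge0 //.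
  by rewrite /l; have := ler_norm K; lra.
exists l => //; split=> //; split=> // [x|x y].
  by apply: differentiable_continuous; exact: (hd x).2.
have := lo y x; have := dot_young (grad h y - grad h x) (y - x) l0.
have := lip y x.
have -> : dot (grad h y) (x - y) = - dot (grad h y) (y - x).
  by rewrite -opprB dotNr.
have -> : dot (x - y) (x - y) = dot (y - x) (y - x).
  by rewrite -opprB !(dotNl, dotNr) opprK.
rewrite (dotDl (grad h y) _ (y - x)) (dotNl (grad h x)).
set N := dot (grad h y - _) _; set D := dot (y - x) (y - x) => h1 h2 h3.
have D0 : 0 <= al / 2 * D by rewrite mulr_ge0 ?divr_ge0 // dot_ge0.
have : N / (2 * l) <= l / 2 * D.
  rewrite ler_pdivrMr ?mulr_gt0 //.
  by have -> : l / 2 * D * (2 * l) = l ^+ 2 * D by field.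
by lra.
Qed.

(** [jacobian] is built from the differential of the vector-valued map, [grad]
    from partial derivatives of one component: they agree because the map is
    differentiable. *)
Lemma row_Jac (R : realType) (n p : nat) (g : 'I_p -> 'rV[R]_n -> \bar R)
    (i : 'I_p) (x : 'rV[R]_n) :
  (forall j, ediffable (g j) x) -> row i (Jac g x) = grad (g i) x.
Proof.
move=> gd; pose G y : 'rV[R]_p := \row_(j < p) fine (g j y).
have Gd : differentiable G x.
  have -> : G = \sum_(j < p) (fun y => fine (g j y) *: delta_mx 0 j).
    apply/funext => y; rewrite fct_sumE /G [LHS]row_sum_delta.
    by apply: eq_bigr => j _; rewrite mxE.
  by apply: differentiable_sum => j; apply: differentiableZl; exact: (gd j).2.
apply/rowP => j; rewrite /Jac 2!mxE [RHS]mxE -/G.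
have -> : (fun y => fine (g i y)) = (fun y => G y 0 i).
  by apply/funext => y; rewrite mxE.
have := derive_mx (diff_derivable (v := delta_mx 0 j) Gd).
move=> /(congr1 (fun N : 'rV[R]_p => N 0 i)); rewrite mxE => <-.
by rewrite deriveE // /jacobian [LHS]mxE.
Qed.

Lemma sandwich_linear (R : realType) (n : nat) (u : 'rV[R]_n) (b : R) :
  sandwich 0 0 (fun x => dot u x - b) (fun=> u).
Proof.
split=> [x|x y|x y].
- have du : dot u y @[y --> x] --> dot u x.
    apply: (cvg_big add_continuous) => [|i _]; first exact: nbhs_filter.
    exact: (cvgM (cvg_cst (u 0 i)) (@coord_continuous _ _ _ 0 i x)).
  exact: (cvgB du (cvg_cst b)).
- by rewrite !dotE; lra.
- by rewrite !dotE; lra.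
Qed.

Lemma nbhs_sqdist (R : realType) (n : nat) (z : 'rV[R]_n) (r : R) : 0 < r ->
  nbhs z [set y | dot (y - z) (y - z) < r].
Proof.
move=> r0.
have : dot (y - z) (y - z) @[y --> z] --> (0 : R).
  rewrite -[X in _ --> X](_ : dot (z - z) (z - z) = 0); last first.
    by rewrite subrr dot0l.
  apply: (cvg_big add_continuous) => [|i _]; first exact: nbhs_filter.
  have H : (y - z) 0 i @[y --> z] --> (z - z) 0 i.
    apply: (@cvg_comp _ _ _ (fun y => y - z) (fun M : 'rV[R]_n => M 0 i)).
      exact: (cvgB cvg_id (cvg_cst z)).
    exact: coord_continuous.
  exact: (cvgM H H).
by move=> /cvgr_lt; apply.
Qed.

(** * The convex program *)

Definition constraints (R : realType) (n p q : nat)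
    (g : 'I_p -> 'rV[R]_n -> \bar R) (A : 'M[R]_(q, n)) (b : 'cV[R]_q)
    (x : 'rV[R]_n) : 'rV[R]_(q + p) :=
  row_mx (A *m x^T - b)^T (\row_(i < p) fine (g i x)).

Lemma constraints_l (R : realType) (n p q : nat)
    (g : 'I_p -> 'rV[R]_n -> \bar R) (A : 'M[R]_(q, n)) (b : 'cV[R]_q)
    (x : 'rV[R]_n) (i : 'I_q) :
  constraints g A b x 0 (lshift p i) = (A *m x^T) i 0 - b i 0.
Proof. by rewrite row_mxEl !mxE. Qed.

Lemma constraints_r (R : realType) (n p q : nat)
    (g : 'I_p -> 'rV[R]_n -> \bar R) (A : 'M[R]_(q, n)) (b : 'cV[R]_q)
    (x : 'rV[R]_n) (i : 'I_p) :
  constraints g A b x 0 (rshift q i) = fine (g i x).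
Proof. by rewrite row_mxEr mxE. Qed.

Lemma convex_program_smooth (R : realType) (n p q : nat)
    (f : 'rV[R]_n -> \bar R) (g : 'I_p -> 'rV[R]_n -> \bar R)
    (A : 'M[R]_(q, n)) (b : 'cV[R]_q) :
  strongly_convex setT f -> lipschitz_gradient f ->
  (forall i, econvex setT (g i)) -> (forall i, lipschitz_gradient (g i)) ->
  exists a lF lc, smooth_problem a lF lc (fun x => fine (f x)) (grad f)
    (constraints g A b) (fun x => col_mx A (Jac g x)).
Proof.
move=> [al al0 fc] fl gc gl.
have [lF lF0 [fs _]] := gradient_sandwich (ltW al0) fc fl.
have /choice [lg lgP] : forall i, exists l, [/\ 0 < l,
    sandwich 0 l (fun x => fine (g i x)) (grad (g i)) &
    forall x y, dot (grad (g i) x - grad (g i) y) (grad (g i) x - grad (g i) y)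
      <= l ^+ 2 * dot (x - y) (x - y)].
  move=> i; have [l l0 []] := gradient_sandwich (lexx 0) (gc i) (gl i).
  by rewrite mul0r; exists l.
have rowJ x i : row i (Jac g x) = grad (g i) x.
  by apply: row_Jac => j; have [] := gl j.
have rowBl (B C : 'M[R]_(p, n)) i :
    row (lshift p i) (col_mx A B - col_mx A C) = 0.
  by rewrite raddfB /= !rowKu subrr.
(* [Jac g x] and [Jac g y] must not be compared by conversion, so the rows are
   rewritten by congruence *)
have rowBr x y i : row (rshift q i) (col_mx A (Jac g x) - col_mx A (Jac g y)) =
    grad (g i) x - grad (g i) y.
  rewrite -[RHS](congr2 (fun u v => u - v) (rowJ x i) (rowJ y i)).
  by move: (Jac g x) (Jac g y) => B C; rewrite raddfB /= !rowKd.
pose lc (k : 'I_(q + p)) := row_mx (0 : 'rV[R]_q) (\row_(i < p) lg i) 0 k.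
have lcl i : lc (lshift p i) = 0 by rewrite /lc row_mxEl mxE.
have lcr i : lc (rshift q i) = lg i by rewrite /lc row_mxEr mxE.
exists (al / 2), lF, lc; split=> //.
- by rewrite divr_gt0.
- move=> k; case: (split_ordP k) => i ->; rewrite ?lcl ?lcr //.
  by have [/ltW] := lgP i.
- move=> k; case: (split_ordP k) => i ->; rewrite ?lcl ?lcr.
    under eq_fun do rewrite constraints_l.
    under [X in sandwich _ _ _ X]eq_fun do rewrite rowKu.
    have := sandwich_linear (row i A) (b i 0); congr sandwich.
    apply/funext => x; congr (_ - _); rewrite /dot mxE.
    by apply: eq_bigr => j _; rewrite !mxE.
  under eq_fun do rewrite constraints_r.
  under [X in sandwich _ _ _ X]eq_fun do rewrite rowKd rowJ.
  by have [] := lgP i.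
- move=> k x y; case: (split_ordP k) => i ->.
    by rewrite rowBl dot0l lcl expr0n mul0r.
  by rewrite rowBr lcr; have [] := lgP i.
Qed.

Lemma dual_function_minimizer (R : realType) (n p q : nat)
    (f : 'rV[R]_n -> \bar R) (g : 'I_p -> 'rV[R]_n -> \bar R)
    (A : 'M[R]_(q, n)) (b : 'cV[R]_q) (z : 'rV[R]_(q + p)) (x : 'rV[R]_n) :
  let L := lagrangian (fun x => fine (f x)) (constraints g A b) in
  (forall x, f x = (fine (f x))%:E) ->
  (forall i x, g i x = (fine (g i x))%:E) ->
  minimizer (L z) x ->
  dual_function f g A b (lsubmx z) (rsubmx z) = (L z x)%:E.
Proof.
move=> L fE gE xmin.
have LE y : (f y + ((lsubmx z *m (A *m y^T - b)) 0 0)%:E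
             + \sum_(i < p) (rsubmx z 0 i)%:E * g i y)%E = (L z y)%:E.
  under eq_bigr do rewrite gE -EFinM.
  rewrite fE sumEFin -!EFinD; congr EFin.
  rewrite /L /lagrangian /dot big_split_ord.
  rewrite addrA; congr (_ + _ + _).
    by rewrite mxE; apply: eq_bigr => i _; rewrite constraints_l !mxE.
  by apply: eq_bigr => i _; rewrite constraints_r !mxE.
apply/eqP; rewrite eq_le; apply/andP; split.
  by apply: ereal_inf_lbound; exists x => //; rewrite LE.
by apply: le_ereal_inf_tmp => _ [y _ <-]; rewrite LE lee_fin.
Qed.

Theorem theorem2p10 (R : realType) (n p q : nat)
    (f : 'rV[R]_n -> \bar R) (g : 'I_p -> 'rV[R]_n -> \bar R)
    (A : 'M[R]_(q, n)) (b : 'cV[R]_q)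
    (A1 : strongly_convex setT f /\ lipschitz_gradient f)
    (A2 : forall i, econvex setT (g i) /\ lipschitz_gradient (g i))
    (A3 : forall x : 'rV[R]_n, primal_optimal f g A b x ->
            row_free (col_mx A (Jac g x)))
    (A4 : exists2 x0 : 'rV[R]_n, relint (sublevel g) x0 & linear_feasible A b x0)
    (lam : 'rV[R]_q) (mu : 'rV[R]_p)
    (Hdual : dual_optimal f g A b lam mu) :
  exists2 N : set 'rV[R]_(q + p), nbhs (row_mx lam mu) N &
    strongly_concave (N `&` [set z | nonneg z])
      (fun z => dual_function f g A b (lsubmx z) (rsubmx z)).
Proof.
have [fc fl] := A1.
have gc i := (A2 i).1; have gl i := (A2 i).2.
have fE := lipschitz_gradient_fin fl.
have gE i := lipschitz_gradient_fin (gl i).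
have [a [lF [lc SP]]] := convex_program_smooth A b fc fl gc gl.
set F := fun x => fine (f x) in SP; set c := constraints g A b in SP.
pose L := lagrangian F c; pose z0 := row_mx lam mu.
have dualE z x : minimizer (L z) x ->
    dual_function f g A b (lsubmx z) (rsubmx z) = (L z x)%:E.
  exact: dual_function_minimizer.
have [lam0 mu0 dmax] := Hdual.
have z00 : nonneg z0.
  by move=> k; case: (split_ordP k) => i ->; rewrite ?row_mxEl ?row_mxEr.
have [x0 x0min] := lagrangian_minimizer SP z00.
have zmax z x : nonneg z -> minimizer (L z) x -> L z x <= L z0 x0.
  move=> zge xmin; rewrite -lee_fin -(dualE _ _ xmin) -(dualE _ _ x0min).
  by rewrite row_mxKl row_mxKr; apply: dmax => i; rewrite mxE.
have [c0 cz0] := dual_max_kkt SP z00 x0min zmax.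
have feasible y : (forall k, c y 0 k <= 0) <->
    (linear_feasible A b `&` sublevel g) y.
  split=> [cy|[ly gy] k].
    split=> i; first by have := cy (lshift p i); rewrite constraints_l subr_le0.
    by have := cy (rshift q i); rewrite constraints_r -lee_fin -gE.
  case: (split_ordP k) => i ->.
    by rewrite /c constraints_l subr_le0; exact: ly.
  by rewrite /c constraints_r -lee_fin -gE; exact: gy.
have x0opt : primal_optimal f g A b x0.
  split=> [|y /feasible cy]; first exact/feasible.
  rewrite fE (fE y) lee_fin; have := x0min y; rewrite /L /lagrangian.
  have -> : dot z0 (c x0) = 0 by rewrite /dot big1.
  have : dot z0 (c y) <= 0.
    by apply: sumr_le0 => k _; rewrite mulr_ge0_le0.
  rewrite /F; lra.
have [r r0 [s s0 super]] := dual_supergradient_near SP z00 x0min (A3 _ x0opt).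
exists [set z | dot (z - z0) (z - z0) < r]; first exact: nbhs_sqdist.
set D := _ `&` _.
have Dconv z z' t : D z -> D z' -> 0 <= t <= 1 -> D (t *: z + (1 - t) *: z').
  move=> [/= zr zge] [/= z'r z'ge] /andP[t0 t1]; have t1' : 0 <= 1 - t by lra.
  split=> /= [|k]; last by rewrite !mxE addr_ge0 ?mulr_ge0.
  have -> : t *: z + (1 - t) *: z' - z0 = t *: (z - z0) + (1 - t) *: (z' - z0).
    rewrite !scalerBr addrACA -opprD -scalerDl.
    by rewrite (addrC t) subrK scale1r.
  move: (z - z0) (z' - z0) zr z'r => u v ur vr.
  (* |t u + (1-t) v|^2 = t |u|^2 + (1-t) |v|^2 - t (1-t) |u - v|^2 *)
  have := mulr_ge0 (mulr_ge0 t0 t1') (dot_ge0 (u - v)).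
  have : t * dot u u + (1 - t) * dot v v < r.
    have := mulr_ge0 t1' (ltW (_ : 0 < r - dot v v)).
    rewrite subr_gt0 => /(_ vr).
    have [tpos|tle0] := ltP 0 t; last first.
      have -> : t = 0 by lra.
      lra.
    have := mulr_gt0 tpos (_ : 0 < r - dot u u); rewrite subr_gt0 => /(_ ur).
    lra.
  rewrite !dotE (dotC v u); lra.
exists (2 * s); first by rewrite mulr_gt0.
split.
- by exists z0; split => //=; rewrite subrr dot0l.
- move=> z z' t; rewrite !inE => Dz Dz'.
  have t01 : 0 <= t%:num <= 1 by rewrite ge0 le1.
  exact: Dconv Dz Dz' t01.
- by move=> z [_ /(lagrangian_minimizer SP) [x /dualE ->]].
move=> z1 z2 t D1 D2 _ _ t01; have Dt := Dconv _ _ _ D1 D2 t01.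
have [x1 m1] := lagrangian_minimizer SP D1.2.
have [x2 m2] := lagrangian_minimizer SP D2.2.
have [x m] := lagrangian_minimizer SP Dt.2.
rewrite (dualE _ _ m) (dualE _ _ m1) (dualE _ _ m2).
rewrite -!EFinN -!EFinM -!EFinD lee_fin enorm_sqr.
(* the supergradient inequality at the convex combination, towards both ends;
   the linear terms cancel in the average with weights t and 1 - t *)
have := super _ _ _ _ Dt.2 D1.2 Dt.1 D1.1 m m1.
have := super _ _ _ _ Dt.2 D2.2 Dt.1 D2.1 m m2.
have -> : z1 - (t *: z1 + (1 - t) *: z2) = (t - 1) *: (z2 - z1).
  apply/rowP => k; rewrite !mxE; ring.
have -> : z2 - (t *: z1 + (1 - t) *: z2) = t *: (z2 - z1).
  apply/rowP => k; rewrite !mxE; ring.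
rewrite !(dotZl _ (z2 - z1)) !(dotZr _ (z2 - z1)).
set G := dot (z2 - z1) (c _); set Q := dot (z2 - z1) (z2 - z1).
rewrite -/L; set T1 := L z1 x1; set T2 := L z2 x2; set T := L _ _ => h2 h1.
case/andP: t01 => t0 t1; have t1' : 0 <= 1 - t by lra.
have := ler_wpM2l t0 h1; have := ler_wpM2l t1' h2; lra.
Qed.
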